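(* Let $\kappa$ be an uncountable cardinal with $\kappa^{<\kappa}=\kappa$. A partial function $f:2^\kappa\to 2^\kappa$ is continuous (with respect to the bounded topology on $2^\kappa$) if and only if it is computable with some oracle.
   Context: The bounded topology on $2^\kappa$ is generated by the sets $\{x\in 2^\kappa : \sigma\subset x\}$ for $\sigma\in 2^{<\kappa}$. A $\kappa$-Turing machine (in the sense of Koepke–Seyfferth) has finitely many read-only input tapes, finitely many read/write scratch tapes and one write-only output tape, all of length $\kappa$, each cell holding $0$ or $1$ (default $0$). It runs for up to $\kappa$ steps: at successor steps it acts like an ordinary Turing machine; at limit steps the content of every cell and the position of every head is the inferior limit of the earlier values. A machine $M$ computes a partial $f:2^\kappa\to2^\kappa$ (type-2 computation) if, given $x\in\mathrm{dom}(f)$ on its input tape, for every $\alpha<\kappa$ there is a stage $\beta<\kappa$ at which $f(x)\upharpoonright\alpha$ is written on the output tape. An oracle machine has an additional read-only tape of length $\kappa$ (the oracle tape); $f$ is computable with an oracle if there is an oracle machine $M$ and $y\in 2^\kappa$ such that $M$ computes $f$ when $y$ is written on the oracle tape.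
   Formalization: The output tape is taken to be one-way (cells are written in order and never revised), and f(x)↾α counts as written only once the machine has actually written those cells; with a revisable tape of default 0 a discontinuous function would be computable. *)

(* Defs.v *)
(* MathComp-Analysis (classical_sets, cardinality, topology) *)
From HB Require Import structures.
From mathcomp Require Import all_boot all_order.
From mathcomp Require Import boolp classical_sets functions cardinality wochoice.
From mathcomp Require Import topology.

Set Implicit Arguments.
Unset Strict Implicit.
Unset Printing Implicit Defensive.

Import Order.TTheory.

Local Open Scope classical_set_scope.
Local Open Scope order_scope.
Local Open Scope card_scope.

(* A cardinal kappa, i.e. an initial ordinal, is represented by a well-ordered
   type K whose proper initial segments [0, a) all have cardinality < |K|;
   elements of K are the ordinals below kappa. *)
Definition is_cardinal d (K : orderType d) : Prop :=
  well_order (<=%O : rel K) /\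
  forall a : K, ~ ([set: K] #<= [set b : K | b < a]).

(* kappa^{<kappa} = kappa, where kappa^{<kappa} is the cardinality of the set
   of all functions from some a < kappa to kappa. *)
Definition lt_power_eq d (K : orderType d) : Prop :=
  [set: {a : K & {b : K | b < a} -> K}] #= [set: K].

Section Ordinals.
Context d (K : orderType d).
Implicit Types a b : K.

Definition is_zero a : Prop := forall b, a <= b.

Definition is_succ a b : Prop := a < b /\ forall c, a < c -> b <= c.

Definition is_limit a : Prop := ~ is_zero a /\ ~ (exists b, is_succ b a).

(* l = sup_{s < a} inf_{s <= t < a} h t *)
Definition is_liminf d' (T : porderType d') (h : K -> T) (a : K) (l : T) :
  Prop :=
  supremums
    [set m | exists2 s, s < a & infimums (h @` [set t | s <= t < a]) m] l.

End Ordinals.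

(* The set 2^kappa; the alias carries the bounded topology instead of any
   topology that K -> bool may have. *)
Definition gcantor d (K : orderType d) : Type := K -> bool.

Section BoundedTopology.
Context d (K : orderType d).

Definition cylinder (a : K) (s : {b : K | b < a} -> bool) : set (gcantor K) :=
  [set x | forall b, x (val b) = s b].

HB.instance Definition _ := Choice.copy (gcantor K) (K -> bool).

HB.instance Definition _ := @isSubBaseTopological.Build (gcantor K)
  (set (gcantor K))
  [set U | exists a (s : {b : K | b < a} -> bool), U = cylinder s] id.

End BoundedTopology.

Inductive move := MoveLeft | Stay | MoveRight.

(* q.+1 states, r read-only tapes, s scratch tapes *)
Record instr (q r s : nat) := Instr {
  next_state : 'I_q.+1;
  ro_move : 'I_r -> move;
  scratch_write : 'I_s -> bool;
  scratch_move : 'I_s -> move;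
  emit : option bool
}.

(* State 0 is initial. No instruction means that the machine halts. The states
   are numbers since, as in Koepke and Seyfferth, the state at a limit step is
   the inferior limit of the earlier ones. *)
Record machine (r : nat) := Machine {
  last_state : nat;
  nscratch : nat;
  program : 'I_last_state.+1 -> {ffun 'I_r -> bool} -> {ffun 'I_nscratch -> bool} ->
            option (instr last_state r nscratch)
}.

Section Runs.
Context d (K : orderType d) (r : nat) (M : machine r).

Record config := Config {
  state : 'I_(last_state M).+1;
  ro_pos : 'I_r -> K;
  scratch_pos : 'I_(nscratch M) -> K;
  scratch : 'I_(nscratch M) -> K -> bool;
  out_pos : K;
  out : K -> bool
}.

Definition initial_config (c : config) : Prop :=
  [/\ state c = ord0,
      (forall i, is_zero (ro_pos c i)),
      (forall j, is_zero (scratch_pos c j)) /\ is_zero (out_pos c),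
      (forall j b, scratch c j b = false)
    & (forall b, out c b = false)].

(* A head at 0 or at a limit position that is moved to the left goes to 0. *)
Definition moved (m : move) (p p' : K) : Prop :=
  match m with
  | MoveLeft => is_succ p' p \/ (~ (exists b, is_succ b p) /\ is_zero p')
  | Stay => p' = p
  | MoveRight => is_succ p p'
  end.

(* The output tape is one-way, as usual in type-2 computability: its head
   moves exactly when it writes, and then one cell to the right. Hence the
   cells to the left of the head are those that have been written, and they
   are never revised. A halted machine keeps its configuration. *)
Definition succ_step (w : 'I_r -> gcantor K) (c c' : config) : Prop :=
  match program (state c) [ffun i => w i (ro_pos c i)]
                          [ffun j => scratch c j (scratch_pos c j)] with
  | None => c' = c
  | Some ins =>
      [/\ state c' = next_state ins,
          (forall i, moved (ro_move ins i) (ro_pos c i) (ro_pos c' i)),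
          (forall j, moved (scratch_move ins j) (scratch_pos c j)
                           (scratch_pos c' j)),
          (forall j b, scratch c' j b =
             if b == scratch_pos c j then scratch_write ins j else scratch c j b)
        & match emit ins with
          | None => out_pos c' = out_pos c /\ forall b, out c' b = out c b
          | Some e => is_succ (out_pos c) (out_pos c') /\
              forall b, out c' b = if b == out_pos c then e else out c b
          end]
  end.

Definition limit_step (c : K -> config) (l : K) : Prop :=
  [/\ is_liminf (state \o c) l (state (c l)),
      (forall i, is_liminf (fun t => ro_pos (c t) i) l (ro_pos (c l) i)),
      (forall j, is_liminf (fun t => scratch_pos (c t) j) l (scratch_pos (c l) j)) /\
      is_liminf (out_pos \o c) l (out_pos (c l)),
      (forall j b, is_liminf (fun t => scratch (c t) j b) l (scratch (c l) j b))
    & (forall b, is_liminf (fun t => out (c t) b) l (out (c l) b))].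

Definition is_run (w : 'I_r -> gcantor K) (c : K -> config) : Prop :=
  [/\ forall t, is_zero t -> initial_config (c t),
      forall t t', is_succ t t' -> succ_step w (c t) (c t')
    & forall l, is_limit l -> limit_step c l].

(* z restricted to a stands written on the output tape *)
Definition written (c : config) (z : gcantor K) (a : K) : Prop :=
  a <= out_pos c /\ forall b, b < a -> out c b = z b.

(* The run exists and is unique when K is a limit ordinal. *)
Definition outputs (w : 'I_r -> gcantor K) (z : gcantor K) : Prop :=
  exists2 c, is_run w c & forall a, exists t, written (c t) z a.

End Runs.

(* M computes the partial function f with domain D, y being on the oracle tape
   (read-only tape 1; read-only tape 0 is the input tape). *)
Definition oracle_computes d (K : orderType d) (M : machine 2) (y : gcantor K)
    (D : set (gcantor K)) (f : gcantor K -> gcantor K) : Prop :=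
  forall x, D x ->
    outputs M (fun i : 'I_2 => if i == ord0 then x else y) (f x).

Definition computable_with_oracle d (K : orderType d)
    (D : set (gcantor K)) (f : gcantor K -> gcantor K) : Prop :=
  exists (M : machine 2) (y : gcantor K), oracle_computes M y D f.

(* Main.v *)
Require Import Defs.
From mathcomp Require Import all_boot all_order.
From mathcomp Require Import boolp classical_sets functions cardinality wochoice.
From mathcomp Require Import topology.

Set Implicit Arguments.
Unset Strict Implicit.
Unset Printing Implicit Defensive.

Local Open Scope classical_set_scope.

(* Computable functions are continuous because at time t every head is at a
   position <= t and the output is never revised: the first a output bits are
   fixed by the input bits below the time at which they have been written.

   Conversely, a single machine serves all continuous f. Its oracle tape is the
   concatenation, over i < kappa, of a string of limit (or zero) length followed
   by the instruction to emit a certain bit or nothing. The machine compares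
   each string with the input; at the end of the string it emits the bit if they
   agree and moves the input head to the left, hence back to cell 0. Strings are
   listed so that the initial segments of a string come before it, so along any
   input the matching strings are its initial segments in increasing order, and
   how much has been emitted before block i is the same for all inputs that
   extend string i. Block i emits the next bit of f whenever string i determines
   it; by continuity this happens for every bit. The list exists because
   kappa^{<kappa} = kappa, and kappa is then regular by diagonalization, which
   keeps the blocks and their concatenation below kappa. *)

Import Order.TTheory.

Local Open Scope order_scope.

(** * Well-ordered types and cardinals *)

Section WellOrder.
Context d (K : orderType d) (K_wo : well_order (<=%O : rel K)).
Implicit Types a b c l s t : K.

Lemma wo_least (P : K -> Prop) :
  (exists x, P x) -> exists2 x, P x & forall y, P y -> x <= y.
Proof.
case=> x0 Px0.
have [|x [[/asboolP Px lex] _]] := K_wo (A := fun x => `[< P x >]).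
  by exists x0; apply/asboolP.
by exists x => // y Py; apply: lex; apply/asboolP.
Qed.

Lemma wo_ind (P : K -> Prop) :
  (forall x, (forall y, y < x -> P y) -> P x) -> forall x, P x.
Proof.
move=> IH x; apply: contrapT => nPx.
have [|y nPy ley] := @wo_least (fun y => ~ P y); first by exists x.
by apply: nPy; apply: IH => z; apply: contraPP => /ley; rewrite leNgt => /negP.
Qed.

Lemma lt_wf : well_founded (fun a b : K => a < b).
Proof. by move=> a; elim/wo_ind: a => a IH; constructor. Qed.

Lemma wo_rec (T : Type) (x0 : T) (F : K -> (K -> T) -> T) :
  (forall t p q, (forall s, s < t -> p s = q s) -> F t p = F t q) ->
  exists p, forall t, p t = F t p.
Proof.
move=> F_ext.
pose G t (r : forall s, s < t -> T) : T :=
  F t (fun s => if pselect (s < t) is left lt_st then r s lt_st else x0).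
have G_ext t r r' : (forall s lt_st, r s lt_st = r' s lt_st) -> G t r = G t r'.
  by move=> rr'; apply: F_ext => s lt_st; case: pselect.
exists (Fix lt_wf (fun=> T) G) => t.
rewrite (Fix_eq _ _ _ G_ext) /G; apply: F_ext => s lt_st.
by case: pselect.
Qed.

Lemma sup_exists (A : set K) u : ubound A u ->
  exists2 l, ubound A l & forall v, ubound A v -> l <= v.
Proof. by move=> ubu; apply: wo_least; exists u. Qed.

Lemma zero_exists a : exists z : K, is_zero z.
Proof.
by have [|z _ z0] := @wo_least (fun=> True); [exists a|exists z => b; apply: z0].
Qed.

Lemma is_zero_uniq a b : is_zero a -> is_zero b -> a = b.
Proof. by move=> a0 b0; apply/le_anti; rewrite a0 b0. Qed.

Lemma is_succ_uniq a b c : is_succ a b -> is_succ a c -> b = c.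
Proof. by move=> [ab minb] [ac minc]; apply/le_anti; rewrite minb ?minc. Qed.

Lemma lt_succ a b c : is_succ a b -> (c < b) = (c <= a).
Proof.
move=> [ab minb]; apply/idP/idP => [cb|/le_lt_trans]; last exact.
by rewrite leNgt; apply/negP => /minb; rewrite leNgt cb.
Qed.

Lemma succ_le a b c : is_succ a b -> (b <= c) = (a < c).
Proof. by move=> ab; rewrite leNgt (lt_succ c ab) -ltNge. Qed.

Lemma is_succ_inj a b c : is_succ a c -> is_succ b c -> a = b.
Proof.
move=> ac bc; apply/le_anti; rewrite -(lt_succ a bc) -(lt_succ b ac).
by rewrite ac.1 bc.1.
Qed.

Lemma not_zero_gt0 z a : is_zero z -> ~ is_zero a -> z < a.
Proof.
by move=> z0 na0; rewrite lt_neqAle z0 andbT; apply/eqP => za; apply: na0; rewrite -za.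
Qed.

Variant ordinal_spec a : Prop :=
| OrdinalZero of is_zero a
| OrdinalSucc b of is_succ b a
| OrdinalLimit of is_limit a.

Lemma ordinalP a : ordinal_spec a.
Proof.
have [a0|na0] := pselect (is_zero a); first exact: OrdinalZero.
have [[b]|nsa] := pselect (exists b, is_succ b a); first exact: OrdinalSucc.
exact: OrdinalLimit.
Qed.

Lemma succ_exists a b : a < b -> exists c : K, is_succ a c.
Proof.
by move=> ab; have [|c ac minc] := @wo_least (fun c => a < c); [exists b|exists c].
Qed.

Lemma limit_succ l s : is_limit l -> s < l -> exists2 t, is_succ s t & t < l.
Proof.
move=> [_ nsl] sl; have [t st] := succ_exists sl; exists t => //.
by rewrite lt_neqAle (succ_le l st) sl andbT; apply/eqP => tl; apply: nsl; exists s; rewrite -tl.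
Qed.

Lemma limit_gt l : is_limit l -> exists s, s < l.
Proof.
move=> [nzl _]; have [z z0] := zero_exists l.
by exists z; apply: not_zero_gt0.
Qed.

End WellOrder.

Section Cardinal.
Context d (K : orderType d) (K_cardinal : is_cardinal K).
Context (K_uncountable : ~ countable [set: K]) (K_lt_power : lt_power_eq K).
Implicit Types a b c l m x y z : K.

Let K_wo : well_order (<=%O : rel K) := K_cardinal.1.

Lemma no_inj_below a (g : K -> K) : injective g -> ~ forall x, g x < a.
Proof.
move=> g_inj g_lt; apply: (K_cardinal.2 a).
have /injfunPex[h] : exists2 h : K -> K,
    set_fun [set: K] [set b | b < a] h & set_inj [set: K] h.
  by exists g => [x _|x y _ _ /g_inj//]; apply: g_lt.
exact: inj_card_le h.
Qed.

Lemma no_surj_below a (g : K -> K) : ~ forall y, exists2 x, x < a & g x = y.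
Proof.
move=> g_surj.
have /choice[h hP] y : exists x, x < a /\ g x = y.
  by have [x] := g_surj y; exists x.
apply: (@no_inj_below a h) => [x y hxy|x]; last exact: (hP x).1.
by rewrite -(hP x).2 hxy (hP y).2.
Qed.

Lemma enum_sequences : exists (len : K -> K) (val : K -> K -> K),
  forall a (g : K -> K), exists k, len k = a /\ forall i, i < a -> val k i = g i.
Proof.
have [noK|/existsNP[z _]] := pselect (forall x : K, False).
  by exists id, (fun=> id) => a; case: (noK a).
pose T := {a : K & {b : K | b < a} -> K}.
have [|T0|[e]] := (@pfcard_geP _ _ [set: T] [set: K] _).
- by have := K_lt_power; rewrite /lt_power_eq card_eq_le => /andP[].
- by have : [set: T] (existT _ z (fun=> z)) by []; rewrite T0.
exists (fun k => tag (e k)), (fun k i =>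
  if pselect (i < tag (e k)) is left lt_i then tagged (e k) (exist _ i lt_i)
  else z).
move=> a g; pose u : T := existT (fun a : K => {b : K | b < a} -> K) a (fun i => g (sval i)).
have [k _ ek] := 'surj_e (I : setT u).
exists k; rewrite ek; split=> //= i lt_i; case: pselect => //.
Qed.

Lemma regular a (c : K -> K) : exists m, forall i, i < a -> c i <= m.
Proof.
have [len [val val_surj]] := enum_sequences.
apply: contrapT => /forallNP unb.
have {}unb m : exists2 i, i < a & m < c i.
  apply: contrapT => ub; apply: (unb m) => i ia.
  by rewrite leNgt; apply/negP => mi; apply: ub; exists i.
have /choice[g gP] i : exists y, forall j, j < c i -> val j i != y.
  apply: contrapT => /forallNP noy; apply: (@no_surj_below (c i) (val^~ i)) => y.
  apply: contrapT => nex; apply: (noy y) => j ji.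
  by apply/eqP => vy; apply: nex; exists j.
have [k [_ vk]] := val_surj a g; have [i ia ki] := unb k.
by have := gP i k ki; rewrite vk ?eqxx.
Qed.

Let next x : K := xget x [set y | is_succ x y].

Let nextP x y : is_succ x y -> next x = y.
Proof. by move=> xy; rewrite /next; case: xgetP => [w _ xw|/(_ y)//]; apply: is_succ_uniq xw xy. Qed.

Let finord x := forall y, y <= x -> is_zero y \/ exists w, is_succ w y.

Let not_all_finord : ~ forall x, finord x.
Proof.
move=> allW; apply: K_uncountable.
have [noK|/existsNP[x0 _]] := pselect (forall x : K, False).
  suff -> : [set: K] = set0 by exact: countable0.
  by apply/seteqP; split => // x; case: (noK x).
have [z z0] := zero_exists K_wo x0.
have -> : [set: K] = (fun n => iter n next z) @` [set: nat].
  apply/seteqP; split => // x _ /=.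
  elim/(wo_ind K_wo): x => x IH.
  have [x0'|[y yx]] := allW x x (lexx x).
    by exists 0%N => //=; apply: is_zero_uniq.
  have [n _ ny] := IH y yx.1; exists n.+1 => //=.
  by rewrite ny; apply: nextP.
exact: card_image_le.
Qed.

Let finord_succ x y : is_succ x y -> finord x -> finord y.
Proof.
move=> xy Wx w; rewrite le_eqVlt (lt_succ w xy) => /predU1P[->|/Wx//].
by right; exists x.
Qed.

Lemma no_max a : exists b, is_succ a b.
Proof.
have [[b /succ_exists]|amax] := pselect (exists b, a < b); first exact.
have {}amax b : b <= a by rewrite leNgt; apply/negP => ab; apply: amax; exists b.
have nWa : ~ finord a.
  by move=> Wa; apply: not_all_finord => x y _; apply/Wa/amax.
have [z z0] := zero_exists K_wo a.
have Wz : finord z.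
  by move=> y yz; left => w; apply: le_trans yz (z0 w).
pose g x := if x == a then z else if `[< finord x >] then next x else x.
have nextS x : finord x -> is_succ x (next x).
  move=> Wx; have xa : x < a.
    by rewrite lt_neqAle amax andbT; apply/eqP => xa; apply: nWa; rewrite -xa.
  by have [y xy] := succ_exists K_wo xa; rewrite (nextP xy).
have Wnext x : finord x -> finord (next x).
  by move=> Wx; apply: (finord_succ (nextS _ Wx) Wx).
have next_neq0 x : finord x -> z <> next x.
  by move=> /nextS[+ _] zx; rewrite -zx ltNge z0.
exfalso; apply: (@no_inj_below a g) => [x y|x]; rewrite /g; last first.
  rewrite lt_neqAle amax andbT; case: (x =P a) => [_|/eqP xa].
    by apply/eqP => za; apply: nWa; rewrite -za.
  by case: asboolP => // Wx; apply/eqP => e; apply: nWa; rewrite -e; apply: Wnext.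
case: (x =P a) => [->|_]; case: (y =P a) => [->|_] //; (try case: asboolP => Wx);
  (try case: asboolP => Wy) => //.
- by move/(next_neq0 _ Wx).
- by move=> zy; rewrite -zy in Wx.
- by move/esym/(next_neq0 _ Wx).
- by move=> xz; rewrite xz in Wx.
- by move=> e; apply: (is_succ_inj (nextS _ Wx)); rewrite e; apply: nextS.
- by move=> e; case: Wy; rewrite -e; apply: Wnext.
- by move=> e; case: Wx; rewrite e; apply: Wnext.
Qed.

Lemma limit_exists : exists l : K, is_limit l.
Proof.
apply: contrapT => nolim; apply: not_all_finord => x y _.
case: (ordinalP y) => [|b|]; [by left|by right; exists b|].
by move=> y_lim; case: nolim; exists y.
Qed.

Lemma nonsucc_unbounded a : exists2 b, a <= b & ~ exists c, is_succ c b.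
Proof.
have [l l_lim] := limit_exists.
pose F t (p : K -> K) :=
  if pselect (exists s, is_succ s t) is left st then next (p (xget t [set s | is_succ s t])) else a.
have [t p q pq|c cE] := wo_rec K_wo a (F := F).
  rewrite /F; case: pselect => // -[s st]; congr next; apply: pq.
  by case: xgetP => [w _ [//]|/(_ s)].
have cS s t : is_succ s t -> is_succ (c s) (c t).
  move=> st; rewrite (cE t) /F; case: pselect => [_|[]]; last by exists s.
  case: xgetP => [w _ wt|/(_ s)//]; rewrite (is_succ_inj wt st).
  by have [b cb] := no_max (c s); rewrite (nextP cb).
have [m c_le] := regular l c.
have [b b_ub b_min] := @sup_exists _ _ K_wo (c @` [set i | i < l]) m
  (fun _ '(ex_intro2 i il e) => eq_ind _ (fun y => y <= m) (c_le i il) _ e).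
exists b.
  have [s sl] := limit_gt K_wo l_lim; have [z z0] := zero_exists K_wo l.
  apply: b_ub; exists z => /=; first exact: le_lt_trans (z0 s) sl.
  by rewrite cE /F; case: pselect => // -[w [wz _]]; have := z0 w; rewrite leNgt wz.
move=> [w wb]; have := wb.1; rewrite ltNge => /negP; apply; apply: b_min.
move=> _ [i il <-]; have [j ij jl] := limit_succ K_wo l_lim il.
rewrite -(lt_succ _ wb); apply: lt_le_trans (cS _ _ ij).1 _.
by apply: b_ub; exists j.
Qed.

Lemma enum_strings : exists (len : K -> K) (str : K -> K -> bool),
  forall a (x : K -> bool) m, exists k,
    [/\ m < k, len k = a & forall b, b < a -> str k b = x b].
Proof.
have [len [val val_surj]] := enum_sequences.
have [l _] := limit_exists; have [z z0] := zero_exists K_wo l.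
have [o zo] := no_max z; have [w ow] := no_max o.
exists (fun k => len (val k z)), (fun k b => val (val k z) b == z) => a x m.
have [k0 [lenk0 valk0]] := val_surj a (fun b => if x b then z else o).
have /choice[k kP] t : exists k, val k z = k0 /\ val k o = t.
  have [k [_ vk]] := val_surj w (fun i => if i == z then k0 else t).
  exists k; rewrite !vk ?ow.1 ?(lt_trans zo.1 ow.1)// eqxx.
  by rewrite gt_eqF// zo.1.
have [t mt] : exists t, m < k t.
  apply: contrapT => /forallNP kle; have [m' mm'] := no_max m.
  apply: (@no_inj_below m' k) => [s t kst|t].
    by rewrite -(kP s).2 kst (kP t).2.
  by rewrite (lt_succ _ mm') leNgt; apply/negP/kle.
exists (k t); split=> //; rewrite (kP t).1// => b ba.
by rewrite valk0//; case: (x b); rewrite ?eqxx// gt_eqF// zo.1.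
Qed.

End Cardinal.

(** * Inferior limits and runs *)

Section Liminf.
Context d (K : orderType d) d' (T : porderType d').
Implicit Types (h : K -> T) (l s t : K) (u v : T).

Lemma liminf_uniq h h' l v v' : (forall t, t < l -> h t = h' t) ->
  is_liminf h l v -> is_liminf h' l v' -> v = v'.
Proof.
move=> hh'; have hE s : h @` [set t | s <= t < l] = h' @` [set t | s <= t < l].
  by apply: eq_imagel => t /= /andP[_]; apply: hh'.
rewrite /is_liminf; set A := (X in supremums X v).
set A' := (X in supremums X v'); suff -> : A = A' by apply: is_subset1_supremums.
by apply/seteqP; split=> m [s sl]; [rewrite hE|rewrite -hE]; exists s.
Qed.

Lemma liminf_cofinal h l v :
    (exists2 s, s < l & forall t, s <= t < l -> v <= h t) ->
    (forall s, s < l -> exists2 t, s <= t < l & h t = v) ->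
  is_liminf h l v.
Proof.
move=> [s0 s0l v_le] v_cof; split=> [m [s sl [m_lb _]]|u u_ub].
  by have [t st <-] := v_cof s sl; apply: m_lb; exists t.
apply: u_ub; exists s0 => //; split=> [_ [t st <-]|m m_lb]; first exact: v_le.
by have [t st <-] := v_cof s0 s0l; apply: m_lb; exists t.
Qed.

Lemma liminf_nondecreasing h l v s0 : s0 < l ->
    (forall s t, s0 <= s -> s <= t < l -> h s <= h t) ->
    (forall t, s0 <= t < l -> h t <= v) ->
    (forall u, (forall t, s0 <= t < l -> h t <= u) -> v <= u) ->
  is_liminf h l v.
Proof.
move=> s0l h_nd h_le v_le; split=> [m [s sl [m_lb _]]|u u_ub].
  apply: (@le_trans _ _ (h (Order.max s s0))).
    by apply: m_lb; exists (Order.max s s0) => //=; rewrite le_max lexx gt_max sl s0l.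
  by apply: h_le; rewrite le_max lexx gt_max sl s0l orbT.
apply: v_le => t /andP[s0t tl]; apply: u_ub; exists t => //.
split=> [_ [t' tt' <-]|m m_lb]; first exact: h_nd.
by apply: m_lb; exists t => //=; rewrite lexx.
Qed.

Lemma liminf_ge h l v s : s < l -> (forall t, s <= t < l -> h s <= h t) ->
  is_liminf h l v -> h s <= v.
Proof.
move=> sl h_ge [v_ub _]; apply: v_ub; exists s => //.
split=> [_ [t st <-]|m m_lb]; first exact: h_ge.
by apply: m_lb; exists s => //=; rewrite lexx.
Qed.

Lemma liminf_le h l v u : (forall t, t < l -> h t <= u) ->
  is_liminf h l v -> v <= u.
Proof.
move=> h_le [_]; apply=> m [s sl [m_lb _]]; apply: le_trans (h_le s sl).
by apply: m_lb; exists s => //=; rewrite lexx.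
Qed.

End Liminf.

Section Runs.
Context d (K : orderType d) (K_wo : well_order (<=%O : rel K)).
Context (r : nat) (M : machine r).
Implicit Types (w : 'I_r -> gcantor K) (c : K -> config K M) (s t l T : K).

Lemma moved_le m (p p' t t' : K) :
  moved m p p' -> is_succ t t' -> p <= t -> p' <= t'.
Proof.
move=> mpp' tt' pt; have pt' := le_lt_trans pt tt'.1.
case: m mpp' => [[[p'p _]|[_ ->//]]|->|pp'].
- exact: ltW (lt_trans p'p pt').
- exact: ltW.
- by rewrite (succ_le _ pp').
Qed.

Lemma moved_uniq m (p p1 p2 : K) : moved m p p1 -> moved m p p2 -> p1 = p2.
Proof.
case: m => [[p1p|[np1 p10]] [p2p|[np2 p20]]|-> ->|] //.
- exact: is_succ_inj p1p p2p.
- by case: np2; exists p1.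
- by case: np1; exists p2.
- exact: is_zero_uniq.
- exact: is_succ_uniq.
Qed.

Lemma ro_pos_le w c t i : is_run w c -> ro_pos (c t) i <= t.
Proof.
move=> [c_init c_succ c_lim]; elim/(wo_ind K_wo): t => t IH.
case: (ordinalP t) => [t0|s st|t_lim].
- by have [_ /(_ i) p0 _ _ _] := c_init _ t0; apply: p0.
- have := c_succ _ _ st; rewrite /succ_step; case: program => [ins|->].
    by case=> _ /(_ i) mv _ _ _; apply: moved_le mv st (IH _ st.1).
  exact: le_trans (IH _ st.1) (ltW st.1).
- have [_ /(_ i) + _ _ _] := c_lim _ t_lim; apply: liminf_le => s st.
  exact: le_trans (IH _ st) (ltW st).
Qed.

Lemma config_eq (C C' : config K M) : state C = state C' ->
    (forall i, ro_pos C i = ro_pos C' i) ->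
    (forall j, scratch_pos C j = scratch_pos C' j) ->
    (forall j b, scratch C j b = scratch C' j b) ->
    out_pos C = out_pos C' -> (forall b, out C b = out C' b) -> C = C'.
Proof.
case: C => s1 r1 p1 c1 o1 u1; case: C' => s2 r2 p2 c2 o2 u2 /=.
move=> -> /funext-> /funext-> c12 -> /funext->; congr Config.
by apply/funext => j; apply/funext.
Qed.

Lemma initial_uniq (C C' : config K M) :
  initial_config C -> initial_config C' -> C = C'.
Proof.
move=> [s1 r1 [p1 o1] c1 u1] [s2 r2 [p2 o2] c2 u2]; apply: config_eq.
- by rewrite s1 s2.
- by move=> i; apply: is_zero_uniq.
- by move=> j; apply: is_zero_uniq.
- by move=> j b; rewrite c1 c2.
- exact: is_zero_uniq.
- by move=> b; rewrite u1 u2.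
Qed.

Lemma succ_step_uniq w w' (C C1 C2 : config K M) :
    (forall i, w i (ro_pos C i) = w' i (ro_pos C i)) ->
  succ_step w C C1 -> succ_step w' C C2 -> C1 = C2.
Proof.
move=> ww'; rewrite /succ_step.
have -> : [ffun i => w i (ro_pos C i)] = [ffun i => w' i (ro_pos C i)].
  by apply/ffunP => i; rewrite !ffunE ww'.
case: program => [ins|-> ->//].
move=> [s1 r1 p1 c1 o1] [s2 r2 p2 c2 o2].
have [oo ou] : out_pos C1 = out_pos C2 /\ forall b, out C1 b = out C2 b.
  case: (emit ins) o1 o2 => [e|] [o1 u1] [o2 u2].
    by split=> [|b]; [apply: is_succ_uniq o1 o2|rewrite u1 u2].
  by split=> [|b]; rewrite ?o1 ?o2// u1 u2.
apply: config_eq => //.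
- by rewrite s1 s2.
- by move=> i; apply: moved_uniq (r1 i) (r2 i).
- by move=> j; apply: moved_uniq (p1 j) (p2 j).
- by move=> j b; rewrite c1 c2.
Qed.

Lemma limit_step_uniq c c' l : (forall t, t < l -> c t = c' t) ->
  limit_step c l -> limit_step c' l -> c l = c' l.
Proof.
move=> cc' [s1 r1 [p1 o1] c1 u1] [s2 r2 [p2 o2] c2 u2]; apply: config_eq.
- by apply: liminf_uniq s1 s2 => t tl /=; rewrite cc'.
- by move=> i; apply: liminf_uniq (r1 i) (r2 i) => t tl /=; rewrite cc'.
- by move=> j; apply: liminf_uniq (p1 j) (p2 j) => t tl /=; rewrite cc'.
- by move=> j b; apply: liminf_uniq (c1 j b) (c2 j b) => t tl /=; rewrite cc'.
- by apply: liminf_uniq o1 o2 => t tl /=; rewrite cc'.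
- by move=> b; apply: liminf_uniq (u1 b) (u2 b) => t tl /=; rewrite cc'.
Qed.

Lemma run_local w w' c c' T : (forall i b, b < T -> w i b = w' i b) ->
  is_run w c -> is_run w' c' -> forall t, t <= T -> c t = c' t.
Proof.
move=> ww' c_run c'_run; elim/(wo_ind K_wo) => t IH tT.
have [c_init c_succ c_lim] := c_run; have [c'_init c'_succ c'_lim] := c'_run.
case: (ordinalP t) => [t0|s st|t_lim].
- exact: initial_uniq (c_init _ t0) (c'_init _ t0).
- have sT := lt_le_trans st.1 tT; have cs := IH _ st.1 (ltW sT).
  have := c'_succ _ _ st; rewrite -cs; apply: succ_step_uniq (c_succ _ _ st) => i.
  by apply: ww'; apply: le_lt_trans (ro_pos_le _ _ c_run) sT.
- apply: limit_step_uniq (c_lim _ t_lim) (c'_lim _ t_lim) => s st.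
  exact: IH st (ltW (lt_le_trans st tT)).
Qed.

Lemma out_stable w c s t : is_run w c -> s <= t ->
  out_pos (c s) <= out_pos (c t) /\
  forall b, b < out_pos (c s) -> out (c t) b = out (c s) b.
Proof.
move=> [c_init c_succ c_lim].
elim/(wo_ind K_wo): t s => t IH s; rewrite le_eqVlt => /predU1P[->//|st].
case: (ordinalP t) => [t0|t' t't|t_lim].
- by have := t0 s; rewrite leNgt st.
- have := st; rewrite (lt_succ _ t't) => /(IH _ t't.1)[st'_pos st'_out].
  have := c_succ _ _ t't; rewrite /succ_step.
  case: program => [ins|->//] [_ _ _ _]; case: (emit ins) => [e|] [o u].
    split=> [|b bs]; first exact: le_trans st'_pos (ltW o.1).
    by rewrite u lt_eqF ?st'_out// (lt_le_trans bs).
  by rewrite o; split=> // b bs; rewrite u st'_out.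
- have [_ _ [_ t_pos] _ t_out] := c_lim _ t_lim; split.
    by apply: liminf_ge t_pos => // t' /andP[st' t't]; apply: (IH _ t't _ st').1.
  move=> b bs; apply: (liminf_uniq (fun _ _ => erefl) (t_out b)).
  apply: liminf_cofinal => [|s' s't].
    by exists s => // t' /andP[st' t't]; rewrite (IH _ t't _ st').2.
  exists (Order.max s s'); first by rewrite le_max lexx orbT gt_max st.
  by apply: (IH _ _ _ _).2; rewrite ?gt_max ?st// le_max lexx.
Qed.

Lemma outputs_local w z a : outputs M w z -> exists T, forall w' z',
  (forall i b, b < T -> w' i b = w i b) -> outputs M w' z' ->
  forall b, b < a -> z' b = z b.
Proof.
move=> [c c_run /(_ a)[T [aT cz]]]; exists T => w' z' w'w [c' c'_run].
move=> /(_ a)[t [at' c'z']] b ba; rewrite -cz// -c'z'//.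
have cT : c T = c' T.
  by apply: (run_local _ c_run c'_run) (lexx T) => i b' b'T; rewrite w'w.
have [tT|/ltW Tt] := leP t T.
  by rewrite cT (out_stable c'_run tT).2// (lt_le_trans ba).
by rewrite (out_stable c'_run Tt).2 -cT// (lt_le_trans ba).
Qed.

End Runs.

(** * The bounded topology *)

Section Continuity.
Context d (K : orderType d) (k0 : K).
Implicit Types (x : gcantor K) (U : set (gcantor K)).

Lemma open_cylinder a s : open (@cylinder d K a s).
Proof.
exists [set cylinder s]; last by rewrite bigcup_set1.
move=> _ ->; apply: (finI_from1 id).
by exists a, s.
Qed.

Lemma nbhs_cylinderP x U :
  nbhs x U <-> exists a : K, forall x', (forall b, b < a -> x' b = x b) -> U x'.
Proof.
rewrite nbhsE /=; split=> [[B [Bo Bx] BU]|[a aU]]; last first.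
  pose s (b : {b : K | b < a}) := x (sval b).
  exists (cylinder s); first by split; [exact: open_cylinder|case].
  by move=> x' sx'; apply: aU => b ba; apply: (sx' (exist _ b ba)).
case: Bo Bx BU => F F_fin <- [W FW Wx] WU.
have [G GD GW] := F_fin W FW.
pose G' : seq (set (gcantor K)) := finmap.enum_fset G.
have WE x' : (W : set (gcantor K)) x' <-> forall V, V \in G' -> V x' by rewrite -GW.
suff [a aG] : exists a : K, forall x', (forall b, b < a -> x' b = x b) ->
    forall V, V \in G' -> V x'.
  by exists a => x' /aG x'G; apply: WU; exists W => //; apply/WE.
have /WE Gx : (W : set (gcantor K)) x by [].
have {}GD V : V \in G' -> exists a s, V = @cylinder d K a s by move/GD/set_mem.
elim: G' {WE} Gx GD => [|V G' IH] Gx GD; first by exists k0.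
have [V' VG|V' VG|a aG] := IH _ _.
- by apply: Gx; rewrite in_cons VG orbT.
- by apply: GD; rewrite in_cons VG orbT.
have [a' [s Vs]] := GD V (mem_head _ _).
have sx : cylinder s x by rewrite -Vs; apply: Gx (mem_head _ _).
exists (Order.max a a') => x' x'x V'; rewrite in_cons => /predU1P[->|VG].
  by rewrite Vs => b; rewrite -sx; apply: x'x; rewrite lt_max (valP b) orbT.
by apply: (aG x') => // b ba; apply: x'x; rewrite lt_max ba.
Qed.

Lemma within_continuousP (D : set (gcantor K)) (f : gcantor K -> gcantor K) :
  {within D, continuous f} <->
  forall x a, D x -> exists b : K, forall x', D x' ->
    (forall c, c < b -> x' c = x c) -> forall c, c < a -> f x' c = f x c.
Proof.
rewrite subspace_continuousP; split=> [f_cont x a Dx|f_loc x Dx U].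
  have /(f_cont x Dx) : nbhs (f x) [set y | forall c : K, c < a -> y c = f x c].
    by apply/nbhs_cylinderP; exists a.
  move=> /nbhs_cylinderP[b bf]; exists b => x' Dx' x'x; exact: bf.
move=> /nbhs_cylinderP[a aU]; have [b bf] := f_loc x a Dx.
apply/nbhs_cylinderP; exists b => x' x'x Dx'; exact/aU/bf.
Qed.

End Continuity.

Lemma computable_continuous d (K : orderType d) (D : set (gcantor K)) f :
    well_order (<=%O : rel K) -> K ->
  computable_with_oracle D f -> {within D, continuous f}.
Proof.
move=> K_wo k0 [M [y My]]; apply/(within_continuousP k0) => x a Dx.
have [T Tx] := outputs_local K_wo a (My x Dx).
exists T => x' Dx' x'x; apply: Tx (My x' Dx') => i b bT.
by case: ifP => // _; apply: x'x.
Qed.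

(** * Layout of the oracle tape *)

Section Layout.
Context d (K : orderType d) (K_wo : well_order (<=%O : rel K)).
Context (z : K) (z0 : is_zero z) (next : K -> K).
Context (nextS : forall x, is_succ x (next x)).
Context (K_regular : forall (a : K) (c : K -> K),
  exists m, forall i, i < a -> c i <= m).
Context (len : K -> K).
Implicit Types (a b i l s t u : K) (A : set K).

(* A cell of the oracle tape has a block, an offset in that block, at which the
   input head stands when the cell is read, and a phase, explained at [code]. *)
Definition layout_step (p : K * K * nat) : K * K * nat :=
  let: (i, b, ph) := p in
  match ph with
  | 0 => (i, b, if b == len i then 2 else 1)
  | 1 => (i, next b, 0)
  | 2 => (i, b, 3)
  | _ => (next i, z, 0)
  end%N.

Definition lub A : K := xget z (supremums A).

Lemma lubP A u : ubound A u -> supremums A (lub A).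
Proof.
move=> Au; rewrite /lub; case: xgetP => [//|noA].
by have [l l_ub l_min] := sup_exists K_wo Au; case: (noA l).
Qed.

(* At a limit of block ends no earlier cell belongs to block [i], and the offset
   is the supremum of the empty set, which is 0. *)
Definition layout_limit l (p : K -> K * K * nat) : K * K * nat :=
  let i := lub [set (p t).1.1 | t in [set t | t < l]] in
  (i, lub [set (p t).1.2 | t in [set t | t < l /\ (p t).1.1 = i]], 0%N).

Definition is_layout (p : K -> K * K * nat) : Prop :=
  [/\ forall t, is_zero t -> p t = (z, z, 0%N),
      forall s t, is_succ s t -> p t = layout_step (p s)
    & forall l, is_limit l -> p l = layout_limit l p].

Lemma layout_exists : exists p, is_layout p.
Proof.
pose F t p := if `[< is_zero t >] then (z, z, 0%N) else
  if `[< exists s, is_succ s t >] then layout_step (p (xget z [set s | is_succ s t]))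
  else layout_limit t p.
have [|t p q pq|p pE] := @wo_rec _ _ K_wo _ _ F; first exact: (z, z, 0%N).
  rewrite /F; case: asboolP => // _; case: asboolP => [[s st]|_].
    by congr layout_step; apply: pq; case: xgetP => [w _ []|/(_ s)].
  rewrite /layout_limit; have -> : [set (p t0).1.1 | t0 in [set t0 | t0 < t]] =
      [set (q t0).1.1 | t0 in [set t0 | t0 < t]].
    by apply: eq_imagel => s /pq->.
  congr (_, lub _, _); apply/seteqP; split=> _ [s [st <-] <-];
    by exists s; rewrite ?pq//; split=> //; rewrite ?pq.
exists p; split=> [t t_0|s t st|l [nzl nsl]]; rewrite pE /F.
- by rewrite asboolT.
- rewrite asboolF; last by move=> /(_ s); rewrite leNgt st.1.
  rewrite asboolT; last by exists s.
  congr (layout_step (p _)); case: xgetP => [w _ wt|/(_ s)//].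
  exact: is_succ_inj wt st.
- by rewrite !asboolF.
Qed.

Context (p : K -> K * K * nat) (p_layout : is_layout p).

Definition blk t := (p t).1.1.
Definition off t := (p t).1.2.
Definition phase t := (p t).2.

Lemma layoutE t : p t = (blk t, off t, phase t).
Proof. by rewrite /blk /off /phase; case: (p t) => -[]. Qed.

Lemma layout0 t : is_zero t -> [/\ blk t = z, off t = z & phase t = 0%N].
Proof. by case: p_layout => p0 _ _ /p0; rewrite /blk /off /phase => ->. Qed.

Lemma layoutS s t : is_succ s t -> (blk t, off t, phase t) =
  layout_step (blk s, off s, phase s).
Proof. by case: p_layout => _ pS _ /pS; rewrite !layoutE. Qed.

Lemma layoutL l : is_limit l ->
  [/\ blk l = lub [set blk t | t in [set t | t < l]],
      off l = lub [set off t | t in [set t | t < l /\ blk t = blk l]]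
    & phase l = 0%N].
Proof. by case: p_layout => _ _ pL /pL; rewrite layoutE /layout_limit => -[-> -> ->]. Qed.

Lemma blk_le t : blk t <= t.
Proof.
elim/(wo_ind K_wo): t => t IH; case: (ordinalP t) => [t0|s st|t_lim].
- by have [-> _ _] := layout0 t0; apply: z0.
- have st1 := IH _ st.1; have bt : blk s <= t := le_trans st1 (ltW st.1).
  have := layoutS st; rewrite /layout_step.
  case: (phase s) => [|[|[|?]]] [-> _ _] //.
  by rewrite (succ_le _ (nextS _)) (le_lt_trans st1 st.1).
- have [-> _ _] := layoutL t_lim.
  have t_ub : ubound [set blk s | s in [set s | s < t]] t.
    by move=> _ [s st <-]; apply: le_trans (IH _ st) (ltW st).
  exact: (lubP t_ub).2.
Qed.

Lemma blk_limit l : is_limit l ->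
  supremums [set blk t | t in [set t | t < l]] (blk l).
Proof.
move=> l_lim; have [-> _ _] := layoutL l_lim; apply: (@lubP _ l).
by move=> _ [s sl <-]; apply: le_trans (blk_le _) (ltW sl).
Qed.

Lemma off_spec t : match phase t return Prop with
  | 0%N => off t <= len (blk t)
  | 1%N => off t < len (blk t)
  | 2%N | 3%N => off t = len (blk t)
  | _ => False
  end.
Proof.
elim/(wo_ind K_wo): t => t IH; case: (ordinalP t) => [t0|s st|t_lim].
- by have [-> -> ->] := layout0 t0; apply: z0.
- have := layoutS st; rewrite /layout_step; have := IH _ st.1.
  case: (phase s) => [|[|[|[|?]]]] + [-> -> ->] //=.
  + by case: eqP => // /eqP nb; rewrite lt_neqAle nb.
  + by rewrite (succ_le _ (nextS _)).
- have [_ -> ->] := layoutL t_lim; rewrite /=.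
  have len_ub : ubound [set off s | s in [set s | s < t /\ blk s = blk t]] (len (blk t)).
    move=> _ [s [st <-] <-]; have := IH _ st.
    by case: (phase s) => [|[|[|[|?]]]] //; [move/ltW|move->|move->].
  exact: (lubP len_ub).2.
Qed.

Lemma off_le t : off t <= len (blk t).
Proof.
by have := off_spec t; case: (phase t) => [|[|[|[|?]]]] //; [move/ltW|move->|move->].
Qed.

Lemma off_limit l : is_limit l ->
  supremums [set off t | t in [set t | t < l /\ blk t = blk l]] (off l).
Proof.
move=> l_lim; have [_ -> _] := layoutL l_lim; apply: (@lubP _ (len (blk l))).
by move=> _ [s [sl <-] <-]; apply: off_le.
Qed.

Lemma layout_mono s t : s <= t ->
  blk s <= blk t /\ (blk s = blk t -> off s <= off t).
Proof.
elim/(wo_ind K_wo): t s => t IH s; rewrite le_eqVlt => /predU1P[->//|st].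
case: (ordinalP t) => [t0|t' t't|t_lim].
- by have := t0 s; rewrite leNgt st.
- have := st; rewrite (lt_succ _ t't) => /(IH _ t't.1)[blk_st' off_st'].
  have := layoutS t't; rewrite /layout_step.
  case: (phase t') => [|[|[|?]]] [-> -> _] //; split=> //.
  + by move=> /off_st' /le_trans; apply; apply: ltW (nextS _).1.
  + exact: le_trans blk_st' (ltW (nextS _).1).
  + by move=> e; move: blk_st'; rewrite e leNgt (nextS _).1.
- split=> [|e]; first by apply: (blk_limit t_lim).1; exists s.
  by apply: (off_limit t_lim).1; exists s.
Qed.

Lemma blk_mono s t : s <= t -> blk s <= blk t.
Proof. by case/layout_mono. Qed.

Let progresses t := exists t',
  [/\ t < t', forall l, is_limit l -> t < l -> t' < l, phase t' = 0%N &
      blk t < blk t' \/ blk t = blk t' /\ off t < off t'].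

Lemma layout_progress t : progresses t.
Proof.
have lim_next s l : is_limit l -> s < l -> next s < l.
  move=> l_lim sl; have [w sw] := limit_succ K_wo l_lim sl.
  by rewrite (is_succ_uniq (nextS s) sw).
have H13 s : (phase s = 1 \/ phase s = 3)%N -> progresses s.
  move=> s13; exists (next s).
  have := layoutS (nextS s); rewrite /layout_step.
  case: s13 => -> [-> -> ->]; split=> //; do ?[exact: (nextS s).1];
    do ?[by move=> l; exact: lim_next].
  - by right; split=> //; exact: (nextS _).1.
  - by left; exact: (nextS _).1.
have chain s s' : is_succ s s' -> blk s' = blk s -> off s' = off s ->
    progresses s' -> progresses s.
  move=> ss'; rewrite /progresses => <- <- [t' [s't' lim0 ph0 adv]].
  exists t'; split=> //; first exact: lt_trans ss'.1 s't'.
  move=> l l_lim sl; apply: lim0 => //.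
  by rewrite -(is_succ_uniq (nextS s) ss'); apply: lim_next.
have H2 s : phase s = 2%N -> progresses s.
  move=> s2; have := layoutS (nextS s); rewrite /layout_step s2 => -[eb eo ep].
  by apply: (chain _ _ (nextS s)) => //; apply: H13; right.
have := layoutS (nextS t); have := off_spec t; rewrite /layout_step.
case E: (phase t) => [|[|[|[|?]]]] // _.
- move=> [eb eo]; case: ifP => _ ep; apply: (chain _ _ (nextS t)) => //.
    exact: H2.
  by apply: H13; left.
- by move=> _; apply: H13; left.
- by move=> _; apply: H2.
- by move=> _; apply: H13; right.
Qed.

Lemma blk_progress t0 : exists t, blk t0 < blk t.
Proof.
apply: contrapT => /forallNP stuck.
have {stuck} blkE t : t0 <= t -> blk t = blk t0.
  by move=> tt0; apply/le_anti; rewrite (blk_mono tt0) andbT leNgt; apply/negP/stuck.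
have /choice[tau tauP] b : exists s, forall t, t0 <= t -> s <= t -> off t <> b.
  have [[s [t0s <-]]|nos] := pselect (exists s, t0 <= s /\ off s = b); last first.
    by exists t0 => t t0t _ e; apply: nos; exists t.
  have [s' [ss' _ _ adv]] := layout_progress s.
  exists s' => t t0t s't e; have t0s' := le_trans t0s (ltW ss').
  case: adv => [|[_]]; first by rewrite !blkE// ltxx.
  by rewrite -e ltNge (layout_mono s't).2// !blkE.
have [m mP] := K_regular (next (len (blk t0))) tau.
have t0t : t0 <= Order.max m t0 by rewrite le_max lexx orbT.
apply: (tauP (off (Order.max m t0)) _ t0t) => //.
rewrite le_max mP// (lt_succ _ (nextS _)) -(blkE _ t0t); exact: off_le.
Qed.

Lemma blk_unbounded i : exists t, i <= blk t.
Proof.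
apply: contrapT => /forallNP bounded.
have /choice[tau tauP] j : exists s, forall t, s <= t -> blk t <> j.
  have [[s <-]|nos] := pselect (exists s, blk s = j); last first.
    by exists z => t _ e; apply: nos; exists t.
  have [s' ss'] := blk_progress s; exists s' => t s't e.
  by have := blk_mono s't; rewrite e leNgt ss'.
have [m mP] := K_regular i tau.
apply: (tauP (blk m) m) => //; apply: mP.
by rewrite ltNge; apply/negP/bounded.
Qed.

Lemma limit_same_block l s : is_limit l -> s < l -> blk s = blk l ->
  forall t, s <= t < l -> blk t = blk l /\ (phase t < 2)%N.
Proof.
move=> l_lim sl sE t /andP[st tl].
have blkE t' : s <= t' < l -> blk t' = blk l.
  move=> /andP[st' t'l]; apply/le_anti; rewrite (blk_mono (ltW t'l)) /=.
  by rewrite -sE blk_mono.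
split; first by rewrite blkE ?st.
have next_ok t' : s <= t' < l -> s <= next t' < l.
  move=> /andP[st' t'l]; rewrite (le_trans st' (ltW (nextS _).1)) /=.
  by have [w tw] := limit_succ K_wo l_lim t'l; rewrite (is_succ_uniq (nextS t') tw).
have not3 t' : s <= t' < l -> phase t' <> 3%N.
  move=> t'P ph3; have := layoutS (nextS t'); rewrite /layout_step ph3 => -[e _ _].
  by have := (nextS (blk t')).1; rewrite -e (blkE _ t'P) (blkE _ (next_ok _ t'P)) ltxx.
have tP : s <= t < l by rewrite st.
have := off_spec t; case E: (phase t) => [|[|[|[|?]]]] // _; last by case: (not3 t).
have := layoutS (nextS t); rewrite /layout_step E => -[_ _ /not3].
by case; apply: next_ok.
Qed.

Lemma limit_new_block l : is_limit l -> (forall s, s < l -> blk s <> blk l) ->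
  off l = z /\ forall s, s < l -> exists2 t, s <= t < l & off t = z /\ phase t = 0%N.
Proof.
move=> l_lim newl; split.
  apply/le_anti; rewrite (z0 (off l)) andbT; apply: (off_limit l_lim).2.
  by move=> _ [s [sl sE] <-]; case: (newl s sl).
move=> s sl; have [t [tl st] t_min] : exists2 t, t < l /\ blk s < blk t &
    forall t', t' < l /\ blk s < blk t' -> t <= t'.
  apply: (wo_least K_wo); apply: contrapT => nex.
  apply: (newl s sl); apply/le_anti; rewrite (blk_mono (ltW sl)) /=.
  apply: (blk_limit l_lim).2 => _ [t tl <-].
  by rewrite leNgt; apply/negP => st; apply: nex; exists t.
have st' : s <= t.
  by rewrite leNgt; apply/negP => /ltW/blk_mono; rewrite leNgt st.
exists t; first by rewrite st'.
case: (ordinalP t) => [t0|t' t't|t_lim].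
- by have [_ -> ->] := layout0 t0.
- have := layoutS t't; rewrite /layout_step.
  suff : phase t' = 3%N by move=> -> [_ -> ->].
  have : blk t' < blk t.
    apply: le_lt_trans st; rewrite leNgt; apply/negP => st2.
    have := t_min t' (conj (lt_trans t't.1 tl) st2).
    by rewrite leNgt t't.1.
  have := off_spec t'; have := layoutS t't; rewrite /layout_step.
  by case: (phase t') => [|[|[|[|?]]]] // [<- _ _]; rewrite ltxx.
- have : blk t <= blk s.
    apply: (blk_limit t_lim).2 => _ [t' t't <-]; rewrite leNgt; apply/negP => st2.
    have := t_min t' (conj (lt_trans t't tl) st2).
    by rewrite leNgt t't.
  by rewrite leNgt st.
Qed.

End Layout.

(** * Emission of the output bits *)

Section Emission.
Context d (K : orderType d) (K_wo : well_order (<=%O : rel K)).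
Context (z : K) (z0 : is_zero z) (next : K -> K).
Context (nextS : forall x, is_succ x (next x)).
Context (K_regular : forall (a : K) (c : K -> K),
  exists m, forall i, i < a -> c i <= m).
Context (K_nonsucc : forall a : K, exists2 b, a <= b & ~ exists c, is_succ c b).
Context (len : K -> K) (str : K -> K -> bool).
Context (str_surj : forall a (x : K -> bool) m, ~ (exists c, is_succ c a) ->
  exists k, [/\ m < k, len k = a & forall b, b < a -> str k b = x b]).
Context (D : set (gcantor K)) (f : gcantor K -> gcantor K).
Context (f_local : forall x a, D x -> exists b : K, forall x', D x' ->
    (forall c, c < b -> x' c = x c) -> forall c, c < a -> f x' c = f x c).
Implicit Types (a b i j k l m : K) (x : gcantor K).

Definition matches i x := forall b, b < len i -> x b = str i b.

Inductive valid i : Prop := Valid of forall a, ~ (exists c, is_succ c a) ->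
  a < len i -> exists j,
    [/\ j < i, len j = a, forall b, b < a -> str j b = str i b & valid j].

Definition predicts (q : gcantor K -> K) i (e : bool) :=
  exists k, forall x, D x -> matches i x -> q x = k /\ f x k = e.

Definition emits (q : gcantor K -> K) i := valid i /\ exists e, predicts q i e.

Definition is_emission (o : K -> gcantor K -> K) : Prop :=
  [/\ forall i x, is_zero i -> o i x = z,
      forall i j x, is_succ i j ->
        o j x = if `[< emits (o i) i /\ matches i x >] then next (o i x) else o i x
    & forall i x, is_limit i -> supremums [set o j x | j in [set j | j < i]] (o i x)].

Lemma emission_exists : exists o, is_emission o.
Proof.
pose F i (q : K -> gcantor K -> K) x := if `[< is_zero i >] then z else
  if `[< exists j, is_succ j i >] then
    let j := xget i [set j | is_succ j i] in
    if `[< emits (q j) j /\ matches j x >] then next (q j x) else q j x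
  else lub z [set q j x | j in [set j | j < i]].
have [|t p q pq|o oE] := @wo_rec _ _ K_wo _ _ F; first exact: (fun=> z).
  apply/funext => x; rewrite /F; case: asboolP => // _; case: asboolP => [[s st]|_].
    by rewrite pq//; case: xgetP => [w _ []|/(_ s)].
  by congr lub; apply: eq_imagel => s /pq->.
have o0 i x : is_zero i -> o i x = z by move=> i0; rewrite oE /F asboolT.
have oS i j x : is_succ i j ->
    o j x = if `[< emits (o i) i /\ matches i x >] then next (o i x) else o i x.
  move=> ij; rewrite [in LHS]oE /F asboolF; last by move=> /(_ i); rewrite leNgt ij.1.
  rewrite asboolT; last by exists i.
  suff -> : xget j [set i | is_succ i j] = i by [].
  by case: xgetP => [w _ wj|/(_ i)//]; apply: is_succ_inj wj ij.
have oL i x : is_limit i -> o i x = lub z [set o j x | j in [set j | j < i]].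
  by move=> [nzi nsi]; rewrite oE /F !asboolF.
have o_le i x : o i x <= i.
  elim/(wo_ind K_wo): i => i IH; case: (ordinalP i) => [i0|j ji|i_lim].
  - by rewrite o0.
  - rewrite (oS _ _ _ ji); case: ifP => _; last exact: le_trans (IH _ ji.1) (ltW ji.1).
    by rewrite (succ_le _ (nextS _)) (le_lt_trans (IH _ ji.1) ji.1).
  - have i_ub : ubound [set o j x | j in [set j | j < i]] i.
      by move=> _ [j ji <-]; apply: le_trans (IH _ ji) (ltW ji).
    by rewrite oL//; apply: (lubP K_wo z i_ub).2.
exists o; split=> // i x i_lim; rewrite oL//; apply: (@lubP _ _ K_wo _ _ i).
by move=> _ [j ji <-]; apply: le_trans (o_le _ _) (ltW ji).
Qed.

Context (o : K -> gcantor K -> K) (o_emission : is_emission o).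

Lemma emission_mono i j x : i <= j -> o i x <= o j x.
Proof.
have [_ oS oL] := o_emission.
elim/(wo_ind K_wo): j i => j IH i; rewrite le_eqVlt => /predU1P[->//|ij].
case: (ordinalP j) => [j0|j' j'j|j_lim].
- by have := j0 i; rewrite leNgt ij.
- move: ij; rewrite (lt_succ _ j'j) => /(IH _ j'j.1) /le_trans; apply.
  by rewrite (oS _ _ _ j'j); case: ifP => // _; apply: ltW (nextS _).1.
- by apply: (oL _ _ j_lim).1; exists i.
Qed.

Definition emitted_bit i := `[< predicts (o i) i true >].

Lemma emitted_bitE i x : D x -> emits (o i) i -> matches i x ->
  emitted_bit i = f x (o i x).
Proof.
rewrite /emitted_bit => Dx [_ [e [k ke]]] ix; have [ok fe] := ke x Dx ix.
case: e ke fe => ke fe; first by rewrite asboolT ?ok ?fe//; exists k.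
rewrite asboolF ?ok ?fe// => -[k' k'e]; have [ok' fe'] := k'e x Dx ix.
by move: fe'; rewrite -ok' ok fe.
Qed.

Lemma valid_exists a x m : ~ (exists c, is_succ c a) ->
  exists i, [/\ m < i, len i = a, matches i x & valid i].
Proof.
elim/(wo_ind K_wo): a m => a IH m a_ns.
have /choice[c cP] b : exists j, b < a -> ~ (exists c, is_succ c b) ->
    [/\ len j = b, matches j x & valid j].
  have [[ba b_ns]|nb] := pselect (b < a /\ ~ exists c, is_succ c b).
    by have [j [_ ? ? ?]] := IH b ba z b_ns; exists j.
  by exists z => ba b_ns; case: nb.
have [m' cm'] := K_regular a c.
have [k [mk lenk strk]] := str_surj x (Order.max m m') a_ns.
move: mk; rewrite gt_max => /andP[mk m'k].
exists k; split=> //; first by move=> b; rewrite lenk => /strk.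
constructor=> b b_ns; rewrite lenk => ba; have [lenc xc vc] := cP b ba b_ns.
exists (c b); split=> // [|b' b'b]; first exact: le_lt_trans (cm' _ ba) m'k.
by rewrite strk ?(lt_trans b'b)// xc// lenc.
Qed.

(* Before [i], the first valid occurrence of its string, no valid string properly
   extends it, since that would require an even earlier occurrence. *)
Lemma emission_local i x : ~ (exists c, is_succ c (len i)) ->
    matches i x -> (forall j, valid j -> len j = len i -> matches j x -> i <= j) ->
  forall x', matches i x' -> forall j, j <= i -> o j x' = o j x.
Proof.
move=> i_ns ix i_min x' ix' j; have [o0 oS oL] := o_emission.
elim/(wo_ind K_wo): j => j IH ji; case: (ordinalP j) => [j0|k kj|j_lim].
- by rewrite !o0.
- have ki : k < i := lt_le_trans kj.1 ji.
  rewrite !(oS _ _ _ kj) (IH _ kj.1 (ltW ki)).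
  have [vk|nvk] := pselect (valid k); last by rewrite !asboolF//; move=> [[]].
  suff kxx' : matches k x' <-> matches k x.
    by congr (if _ then _ else _); apply: asbool_equiv_eq; rewrite kxx'.
  have [leki|ltik] := leP (len k) (len i).
    have xx' b : b < len k -> x' b = x b.
      by move=> bk; have bi := lt_le_trans bk leki; rewrite ix// ix'.
    by split=> kx b bk; rewrite -kx// xx'.
  have no y : matches i y -> ~ matches k y.
    move=> iy ky; case: vk => /(_ _ i_ns ltik)[k' [k'k lenk' strk' vk']].
    suff : i <= k' by rewrite leNgt (lt_trans k'k ki).
    apply: i_min => // b; rewrite lenk' => bi; rewrite strk'// ix// -iy// ky//.
    exact: lt_trans ltik.
  by split=> /no; case.
- apply: (@is_subset1_supremums _ _ [set o k x | k in [set k | k < j]]).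
    suff -> : [set o k x | k in [set k | k < j]] = [set o k x' | k in [set k | k < j]].
      exact: oL.
    by apply: eq_imagel => k kj; rewrite IH// (le_trans (ltW kj)).
  exact: oL.
Qed.

Lemma emission_progress i0 x : D x -> exists i, o i0 x < o i x.
Proof.
move=> Dx; apply: contrapT => /forallNP stuck.
have {stuck} oE i : i0 <= i -> o i x = o i0 x.
  move=> i0i; apply/le_anti; rewrite (emission_mono _ i0i) andbT leNgt.
  exact/negP/stuck.
have [b bf] := f_local (next (o i0 x)) Dx.
have [m lenm] := K_regular (next i0) len.
have [a] := K_nonsucc (Order.max (next m) b).
rewrite ge_max => /andP[ma ba] a_ns.
have [i [vi lena ix] i_min] : exists2 i, [/\ valid i, len i = a & matches i x] &
    forall j, [/\ valid j, len j = a & matches j x] -> i <= j.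
  by apply: (wo_least K_wo); have [i []] := valid_exists x z a_ns; exists i.
have i0i : i0 <= i.
  rewrite leNgt; apply/negP => ii0; have := lenm i.
  rewrite (lt_succ _ (nextS _)) (ltW ii0) lena => /(_ isT).
  by rewrite leNgt (lt_le_trans (nextS _).1 ma).
have := oE (next i) (le_trans i0i (ltW (nextS _).1)).
have [_ oS _] := o_emission; rewrite (oS _ _ _ (nextS _)) (oE i)// asboolT.
  by move=> e; have := (nextS (o i0 x)).1; rewrite e ltxx.
split=> //; split=> //; exists (f x (o i0 x)), (o i0 x) => x' Dx' ix'.
split.
  rewrite -(oE i)//; apply: emission_local ix' _ (lexx i) => //; first by rewrite lena.
  by move=> j vj lenj jx; apply: i_min; rewrite lenj lena.
apply: (bf x' Dx') (nextS _).1 => c cb.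
by rewrite ix ?ix'// lena (lt_le_trans cb).
Qed.

Lemma emission_unbounded k x : D x -> exists i, k <= o i x.
Proof.
move=> Dx; elim/(wo_ind K_wo): k => k IH.
have /choice[c cP] k' : exists i, k' < k -> k' <= o i x.
  by have [/IH[i ik]|k'k] := boolP (k' < k); [exists i|exists z].
have [m cm] := K_regular k c; have [i mi] := emission_progress m Dx.
exists i; rewrite leNgt; apply/negP => ik.
have := le_trans (cP _ ik) (emission_mono x (cm _ ik)).
by rewrite leNgt mi.
Qed.

End Emission.

(** * The machine *)

Definition code (ok : bool) (ph : nat) : 'I_8 := inord (if ok then ph else 4 + ph)%N.

Lemma codeK ok ph : (ph < 4)%N ->
  ((code ok ph < 4) = ok /\ code ok ph %% 4 = ph)%N.
Proof. by case: ok; case: ph => [|[|[|[|?]]]] //; rewrite /code inordK. Qed.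

(* The state [code ok ph] records whether the input has agreed with the current
   block so far, and the role of the oracle cell being read:
   0 - does the string of the block end here;  1 - a bit of the string;
   2 - may the block emit;  3 - the bit to be emitted.
   Failure gets the larger codes since it persists until the end of the block,
   whereas the inferior limit of states at a limit of blocks must be
   [code true 0]. *)
Definition interpreter_step (s : 'I_8) (w : {ffun 'I_2 -> bool}) :
    option (instr 7 2 0) :=
  let ok := (s < 4)%N in
  let go ok' ph m e := Some (Instr (code ok' ph)
    (fun i : 'I_2 => if i == ord0 then m else MoveRight)
    (fun=> false) (fun=> Stay) e) in
  match (s %% 4)%N with
  | 0 => go ok (if w ord_max then 2 else 1) Stay None
  | 1 => go (ok && (w ord0 == w ord_max)) 0 MoveRight None
  | 2 => go (ok && w ord_max) 3 Stay None
  | _ => go true 0 MoveLeft (if ok then Some (w ord_max) else None)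
  end%N.

Definition interpreter : machine 2 :=
  @Machine 2 7 0 (fun s w _ => interpreter_step s w).

Section Interpreter.
Context d (K : orderType d) (K_wo : well_order (<=%O : rel K)).
Context (z : K) (z0 : is_zero z) (next : K -> K).
Context (nextS : forall x, is_succ x (next x)).
Context (len : K -> K) (str : K -> K -> bool).
Context (len_nonsucc : forall i, ~ exists c, is_succ c (len i)).
Context (D : set (gcantor K)) (f : gcantor K -> gcantor K).
Context (p : K -> K * K * nat) (p_layout : is_layout z next len p).
Context (o : K -> gcantor K -> K) (o_emission : is_emission z next len str D f o).
Implicit Types (a b i j l s t : K) (x : gcantor K).

Let blk := blk p.
Let off := off p.
Let phase := phase p.
Let emit_ok i := emits len str D f (o i) i.

Definition oracle : gcantor K := fun t =>
  match phase t with
  | 0 => off t == len (blk t)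
  | 1 => str (blk t) (off t)
  | 2 => `[< emit_ok (blk t) >]
  | _ => emitted_bit len str D f o (blk t)
  end%N.

Context (x : gcantor K) (Dx : D x).

Definition agrees t := `[< (forall b, b < off t -> x b = str (blk t) b) /\
  (phase t = 3%N -> emit_ok (blk t)) >].

Definition trace t : config K interpreter := @Config _ K 2 interpreter
  (code (agrees t) (phase t)) (fun h => if h == ord0 then off t else t)
  (fun=> z) (fun _ _ => false) (o (blk t) x)
  (fun b => if b < o (blk t) x then f x b else false).

Let w (h : 'I_2) : gcantor K := if h == ord0 then x else oracle.

Lemma trace_initial t : is_zero t -> initial_config (trace t).
Proof.
move=> t0; have [b0 f0 p0] := layout0 p_layout t0; have [o0 _ _] := o_emission.
have oz : o (blk t) x = z by rewrite /blk b0 o0.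
split=> /=.
- rewrite /agrees asboolT /off /phase ?f0 ?p0.
    by apply: val_inj; rewrite /= inordK.
  by split=> // b; rewrite ltNge z0.
- by move=> i; case: ifP => // _; rewrite /off f0.
- by split=> [[]|]; rewrite ?oz.
- by [].
- by move=> b; rewrite oz ltNge z0.
Qed.

Lemma trace_succ t t' : is_succ t t' -> succ_step w (trace t) (trace t').
Proof.
move=> tt'; have := layoutS p_layout tt'.
have := off_spec K_wo z0 nextS p_layout t.
rewrite /layout_step /succ_step /= /interpreter_step.
rewrite -/blk -/off -/phase => offP stepE.
have ph4 : (phase t < 4)%N by move: offP; case: (phase t) => [|[|[|[|?]]]].
have [-> ->] := codeK (agrees t) ph4; rewrite !ffunE /=.
have -> : w ord0 = x by []; have -> : w ord_max = oracle by []; rewrite /oracle.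
case E: (phase t) offP stepE => [|[|[|[|?]]]] //= offP [eb eo ep].
- split=> /= [|h|[]//|[]//|]; rewrite ?eb//.
    rewrite ep; congr (code _ _); rewrite /agrees; apply: asbool_equiv_eq; rewrite eb eo ep E.
    by split=> -[H _]; split=> //; case: ifP.
  by case: ifP => _.
- split=> /= [|h|[]//|[]//|]; rewrite ?eb//.
    rewrite ep; congr (code _ _); apply/idP/andP.
      move=> /asboolP[H _]; split; last by rewrite -eb; apply/eqP/H; rewrite eo (nextS _).1.
      apply/asboolP; split; last by rewrite E.
      by move=> b bt; rewrite -eb; apply: H; rewrite eo (lt_trans bt (nextS _).1).
    move=> [/asboolP[H _] /eqP xt]; apply/asboolP; rewrite eb eo ep; split=> // b.
    by rewrite (lt_succ _ (nextS _)) le_eqVlt => /predU1P[->|/H].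
  by case: ifP => _ //=; rewrite eo; apply: nextS.
- split=> /= [|h|[]//|[]//|]; rewrite ?eb//.
    rewrite ep; congr (code _ _); apply/idP/andP.
      move=> /asboolP[H H3]; rewrite eb eo ep in H H3.
      by split; apply/asboolP; [split=> //; rewrite E|apply: H3].
    by move=> [/asboolP[H _] /asboolP eok]; apply/asboolP; rewrite eb eo ep.
  by case: ifP => _.
- have [_ oS _] := o_emission.
  have agreesE : agrees t = `[< emit_ok (blk t) /\ matches len str (blk t) x >].
    rewrite /agrees; apply: asbool_equiv_eq; rewrite E offP; split=> [[H H3]|[eok H]]; split=> //.
    exact: H3.
  split=> /= [|h|[]//|[]//|].
  + rewrite ep; congr (code _ _); apply/asboolP; rewrite eo ep; split=> // b.
    by rewrite ltNge z0.
  + case: ifP => _ //=; right; rewrite offP eo; split=> //; exact: len_nonsucc.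
  + rewrite eb (oS _ _ _ (nextS _)) -agreesE.
    case: ifP => // agr; move: (agr); rewrite agreesE => /asboolP[eok mx].
    split=> [|b]; first exact: nextS.
    rewrite (lt_succ _ (nextS _)) le_eqVlt; case: eqP => [->|//] /=.
    by rewrite (emitted_bitE Dx).
Qed.

Lemma phase0_cofinal l s : is_limit l -> s < l ->
  exists2 t, s <= t < l & phase t = 0%N.
Proof.
move=> l_lim sl.
have [t [st tl ph0 _]] := layout_progress K_wo z0 nextS p_layout s.
by exists t => //; rewrite (ltW st) tl.
Qed.

Lemma code_agrees_ge t : (if agrees t then code true 0 else code false 0) <= code (agrees t) (phase t).
Proof.
have : (phase t < 4)%N.
  by have := off_spec K_wo z0 nextS p_layout t; rewrite -/(phase t); case: (phase t) => [|[|[|[|?]]]].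
by rewrite leEord /code; case: (agrees t); case: (phase t) => [|[|[|[|?]]]] // _; rewrite !inordK.
Qed.

Lemma code_ge ok ph : code true 0 <= code ok ph.
Proof. by rewrite leEord /code inordK. Qed.

Lemma trace_limit l : is_limit l -> limit_step trace l.
Proof.
move=> l_lim; have [_ _ ph_l] := layoutL p_layout l_lim.
have [_ _ oL] := o_emission.
have zl : z < l by apply: not_zero_gt0 => //; case: l_lim.
pose same := exists2 s, s < l & blk s = blk l.
have new_block : ~ same -> off l = z /\ forall s, s < l ->
    exists2 t, s <= t < l & off t = z /\ phase t = 0%N.
  move=> nsame; apply: (limit_new_block K_wo z0 nextS p_layout l_lim) => s sl sE.
  by apply: nsame; exists s.
have same_block : same -> exists2 s, s < l &
    forall t, s <= t < l -> blk t = blk l /\ (phase t < 2)%N.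
  move=> [s sl sE]; exists s => //.
  exact: (limit_same_block K_wo z0 nextS p_layout l_lim sl sE).
have o_mono s t : s <= t -> o (blk s) x <= o (blk t) x.
  move=> st; apply: (emission_mono K_wo nextS o_emission).
  exact: (blk_mono K_wo z0 nextS p_layout st).
have o_sup u : (forall t, t < l -> o (blk t) x <= u) -> o (blk l) x <= u.
  move=> ou; have [[s sl <-]|nsame] := pselect same; first exact: ou.
  have below j : j < blk l -> exists2 t, t < l & j < blk t.
    move=> jl; apply: contrapT => nex; move: jl; rewrite ltNge => /negP; apply.
    apply: (blk_limit K_wo z0 nextS p_layout l_lim).2 => _ [t tl <-].
    by rewrite leNgt; apply/negP => jt; apply: nex; exists t.
  have blk_lt t : t < l -> blk t < blk l.
    move=> tl; rewrite lt_neqAle (blk_mono K_wo z0 nextS p_layout (ltW tl)) andbT.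
    by apply/eqP => e; apply: nsame; exists t.
  have bl_lim : is_limit (blk l).
    split=> [bl0|[j jl]].
      by have := blk_lt z zl; rewrite ltNge bl0.
    have [t tl jt] := below j jl.1; have := blk_lt t tl.
    by rewrite (lt_succ _ jl) leNgt jt.
  apply: (oL _ x bl_lim).2 => _ [j jl <-].
  have [t tl jt] := below j jl; apply: le_trans (ou t tl).
  exact: (emission_mono K_wo nextS o_emission x (ltW jt)).
have agrees0 t : phase t = 0%N -> blk t = blk l -> off t <= off l ->
    agrees l -> agrees t.
  move=> pt bt ot /asboolP[al _]; apply/asboolP; rewrite bt pt; split=> // b bo.
  by apply: al; apply: lt_le_trans ot.
have agrees_new t : off t = z -> phase t = 0%N -> agrees t.
  by move=> ot pt; apply/asboolP; rewrite ot pt; split=> // b; rewrite ltNge z0.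
have [off_ub off_lub] := off_limit K_wo z0 nextS p_layout l_lim.
split=> /=.
- rewrite [phase l]ph_l; have [sameP|nsame] := pselect same; last first.
    have [ol ol_cof] := new_block nsame; rewrite (agrees_new l)//.
    apply: liminf_cofinal => [|s sl]; first by exists z => // t _; apply: code_ge.
    have [t st [ot pt]] := ol_cof s sl; exists t => //=.
    by rewrite agrees_new// pt.
  have [s sl sP] := same_block sameP.
  case: (boolP (agrees l)) => [al|/asboolPn nal].
    apply: liminf_cofinal => [|s' s'l]; first by exists z => // t _; apply: code_ge.
    have ml : Order.max s s' < l by rewrite gt_max sl.
    have [t] := phase0_cofinal l_lim ml; rewrite ge_max => /andP[/andP[st s't] tl] pt.
    exists t; rewrite ?s't//= pt; congr (code _ _); apply: agrees0 => //.
      by rewrite (sP t _).1// st.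
    by apply: off_ub; exists t => //=; split=> //; rewrite -/(blk t) (sP t _).1// st.
  have [t1 t1l bad] : exists2 t1, t1 < l & forall t, t1 <= t < l -> ~~ agrees t.
    have [b bl xb] : exists2 b, b < off l & x b <> str (blk l) b.
      apply: contrapT => nex; apply: nal; split; last by rewrite /phase ph_l.
      by move=> b bl; apply: contrapT => xb; apply: nex; exists b.
    have [t1 [t1l bt1] ob] : exists2 t1, t1 < l /\ blk t1 = blk l & b < off t1.
      apply: contrapT => nex; move: bl; rewrite ltNge => /negP; apply.
      apply: off_lub => _ [t [tl bt] <-].
      by rewrite leNgt; apply/negP => bo; apply: nex; exists t.
    exists (Order.max s t1); first by rewrite gt_max sl.
    move=> t; rewrite ge_max => /andP[/andP[st t1t] tl]; apply/asboolPn => -[at_ _].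
    have bt : blk t = blk l by rewrite (sP t _).1// st.
    apply: xb; rewrite -bt at_//; apply: lt_le_trans ob _.
    by apply: (layout_mono K_wo z0 nextS p_layout t1t).2; rewrite -/(blk t1) bt1.
  apply: liminf_cofinal => [|s' s'l].
    exists t1 => // t t1t /=; have := code_agrees_ge t.
    by rewrite (negbTE (bad t t1t)).
  have ml : Order.max t1 s' < l by rewrite gt_max t1l.
  have [t] := phase0_cofinal l_lim ml; rewrite ge_max => /andP[/andP[t1t s't] tl] pt.
  by exists t; rewrite ?s't//= pt (negbTE (bad t _))// t1t.
- move=> h; case: ifP => _; last first.
    apply: (@liminf_nondecreasing _ _ _ _ _ _ _ z) => // [s t _ /andP[]//|t /andP[_ /ltW]//|u ul].
    rewrite leNgt; apply/negP => lu; have [u' uu' u'l] := limit_succ K_wo l_lim lu.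
    by have := ul u'; rewrite z0 u'l leNgt uu'.1 => /(_ isT).
  have [sameP|nsame] := pselect same; last first.
    have [-> ol_cof] := new_block nsame.
    apply: liminf_cofinal => [|s sl]; first by exists z.
    by have [t st [ot _]] := ol_cof s sl; exists t.
  have [s sl sP] := same_block sameP.
  have off_mono t t' : t <= t' -> blk t = blk t' -> off t <= off t'.
    by move=> tt'; apply: (layout_mono K_wo z0 nextS p_layout tt').2.
  apply: (liminf_nondecreasing sl) => [t t' st /andP[tt' t'l]|t st|u uo].
  + apply: off_mono => //; rewrite (sP t _).1 ?st ?(le_lt_trans tt')//.
    by rewrite (sP t' _).1// (le_trans st).
  + by apply: off_ub; exists t => //=; split; [case/andP: st|apply: (sP t st).1].
  + apply: off_lub => _ [t [tl bt] <-]; have [st|ts] := leP s t.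
      by apply: uo; rewrite st.
    apply: le_trans (uo s _); last by rewrite lexx.
    by apply: off_mono (ltW ts) _; rewrite (sP s _).1// lexx.
- split=> [[]//|].
  apply: (@liminf_nondecreasing _ _ _ _ _ _ _ z) => // [s t _ /andP[st _]|t /andP[_ tl]|u ou] /=.
  + exact: o_mono.
  + exact/o_mono/ltW.
  + by apply: o_sup => t tl; apply: ou; rewrite z0.
- by case.
- move=> b; have [bo|nbo] := ltP b (o (blk l) x); last first.
    have out0 t : t < l -> (if b < o (blk t) x then f x b else false) = false.
      move=> tl; case: ltP => // bt; have := lt_le_trans bt (o_mono _ _ (ltW tl)).
      by rewrite ltNge nbo.
    apply: liminf_cofinal => [|s sl]; first by exists z.
    by exists s; rewrite ?lexx//= out0.
  have [s sl bs] : exists2 s, s < l & b < o (blk s) x.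
    apply: contrapT => nex; move: bo; rewrite ltNge => /negP; apply.
    by apply: o_sup => t tl; rewrite leNgt; apply/negP => bt; apply: nex; exists t.
  apply: liminf_cofinal => [|s' s'l].
    by exists s => // t /andP[st tl]; rewrite (lt_le_trans bs (o_mono _ _ st)).
  exists (Order.max s s'); first by rewrite le_max lexx orbT gt_max sl.
  by rewrite (lt_le_trans bs)// o_mono// le_max lexx.
Qed.

Lemma trace_run : is_run w trace.
Proof. by split; [exact: trace_initial|exact: trace_succ|exact: trace_limit]. Qed.

Lemma trace_written t a : a <= o (blk t) x -> written (trace t) (f x) a.
Proof. by move=> ao; split=> //= b ba; rewrite (lt_le_trans ba). Qed.

End Interpreter.

Lemma continuous_computable d (K : orderType d)
    (K_cardinal : is_cardinal K) (K_uncountable : ~ countable [set: K])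
    (K_lt_power : lt_power_eq K) (k0 : K)
    (D : set (gcantor K)) (f : gcantor K -> gcantor K) :
  {within D, continuous f} -> computable_with_oracle D f.
Proof.
move=> /(within_continuousP k0) f_local; have K_wo := K_cardinal.1.
have [z z0] := zero_exists K_wo k0.
have /choice[next nextS] := no_max K_cardinal K_uncountable.
have K_regular := regular K_cardinal K_lt_power.
have K_nonsucc := nonsucc_unbounded K_cardinal K_uncountable K_lt_power.
have [len0 [str str_surj0]] := enum_strings K_cardinal K_uncountable K_lt_power.
pose len i := if `[< exists c, is_succ c (len0 i) >] then z else len0 i.
have len_nonsucc i : ~ exists c, is_succ c (len i).
  rewrite /len; case: asboolP => // _ [c [cz _]].
  by have := z0 c; rewrite leNgt cz.
have str_surj a (x : K -> bool) m : ~ (exists c, is_succ c a) ->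
    exists k, [/\ m < k, len k = a & forall b, b < a -> str k b = x b].
  move=> a_ns; have [k [mk lenk strk]] := str_surj0 a x m.
  by exists k; split=> //; rewrite /len lenk asboolF.
have [p p_layout] := layout_exists K_wo z next len.
have [o o_emission] := emission_exists K_wo z0 nextS len str D f.
exists interpreter, (oracle len str D f p o) => x Dx.
exists (trace z len str D f p o x).
  exact: trace_run.
move=> a; have [i ai] := emission_unbounded K_wo nextS K_regular K_nonsucc
  str_surj f_local o_emission a Dx.
have [t it] := blk_unbounded K_wo z0 nextS K_regular p_layout i.
exists t; apply: trace_written; apply: le_trans ai _.
exact: (emission_mono K_wo nextS o_emission).
Qed.

Close Scope order_scope.

(* The partial function is f restricted to its domain D. *)
Theorem theorem5 (d : Order.disp_t) (K : orderType d)
    (K_cardinal : is_cardinal K) (K_uncountable : ~ countable [set: K])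
    (K_lt_power : lt_power_eq K)
    (D : set (gcantor K)) (f : gcantor K -> gcantor K) :
  {within D, continuous f} <-> computable_with_oracle D f.
Proof.
have [K0|/existsNP[k0 _]] := pselect (forall x : K, False).
  case: K_uncountable; suff -> : [set: K] = set0 by exact: countable0.
  by apply/seteqP; split=> // x; case: (K0 x).
split; first exact: (continuous_computable _ _ _ k0).
by apply: computable_continuous => //; case: K_cardinal.
Qed.
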